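(* Let $N$ be a simple rank-$r$ binary matroid with critical number $c \ge 2$, and let $\delta \in \left\{0,\tfrac{1}{4},\tfrac{1}{2}\right\}$ be minimal such that $N|S \in \mathcal{N}_{\delta}$ for some $(c-2)$-codimensional subspace $S$ of $N$. Then the critical threshold for $N$ is at least $1 - (1-\delta)2^{2-c}$.
   Context: Matroids are finite. For a matroid $M$, $E(M)$ is its ground set, $|M| = |E(M)|$, $r(M)$ is its rank, and $M|S$ is the restriction to $S$. A simple binary matroid of rank $n$ is viewed as a restriction of the projective geometry $G \cong \mathrm{PG}(n-1,2)$ (equivalently, as a set of nonzero vectors in $\mathrm{GF}(2)^n$). The critical number $\chi(M)$ is the minimum nonnegative integer $c$ such that $G$ has a rank-$(n-c)$ flat disjoint from $E(M)$. For a simple binary matroid $N$, the critical threshold of $N$ is the infimum of all real $\alpha > 0$ such that there exists $c' = c'(N,\alpha)$ for which every simple binary matroid $M$ with no restriction isomorphic to $N$ and with $|M| \ge \alpha 2^{r(M)}$ satisfies $\chi(M) \le c'$. If $k \ge 0$ is an integer and $M$ is a simple rank-$n$ binary matroid, viewed as a restriction of $G \cong \mathrm{PG}(n-1,2)$, a $k$-codimensional subspace of $M$ is a set of the form $F \cap E(M)$, where $F$ is a rank-$(n-k)$ flat of $G$ (such a set may have rank smaller than $n-k$, and may be empty). Let $\mathcal{N}$ be the class of simple binary matroids of critical number $2$. It is partitioned into three subclasses: - $\mathcal{N}_0$ is the class of all $N \in \mathcal{N}$ having a $1$-codimensional subspace $S$ such that $S$ is independent in $N$ and each odd circuit of $N$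 (circuit with an odd number of elements) contains at least four elements of $E(N)-S$. - $\mathcal{N}_{1/4}$ is the class of all $N \in \mathcal{N} - \mathcal{N}_0$ such that some $1$-codimensional subspace of $N$ is independent in $N$. - $\mathcal{N}_{1/2} = \mathcal{N} - (\mathcal{N}_0 \cup \mathcal{N}_{1/4})$. Every simple binary matroid $N$ of critical number $c \ge 2$ has a $(c-2)$-codimensional subspace $S$ with $\chi(N|S) = 2$, so the minimum defining $\delta$ is well-defined. *)

(* Defs.v *)
From HB Require Import structures.
From mathcomp Require Import all_boot all_order all_algebra.
From mathcomp Require Import all_classical all_reals.

Set Implicit Arguments.
Unset Strict Implicit.
Unset Printing Implicit Defensive.

Import Order.TTheory GRing.Theory Num.Theory.
Local Open Scope ring_scope.

(* A simple binary matroid is a set of nonzero vectors of some GF(2)^n, which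
   need not span GF(2)^n: the projective geometry of a matroid M, with respect
   to which flats and codimensions are taken below, consists of the nonzero
   vectors of the span of its ground set, so that it has the rank of M. *)
Record sbmatroid := SBMatroid {
  ambient : nat;
  ground : {set 'rV['F_2]_ambient};
  ground_simple : 0 \notin ground }.

Definition indep n (X : {set 'rV['F_2]_n}) : bool := free (enum X).

Definition geometry (M : sbmatroid) : {vspace 'rV['F_2]_(ambient M)} :=
  <<enum (ground M)>>%VS.

Definition rank (M : sbmatroid) : nat := \dim (geometry M).

Definition circuit (M : sbmatroid) (C : {set 'rV['F_2]_(ambient M)}) : bool :=
  minset [pred X : {set 'rV['F_2]_(ambient M)}
         | (X \subset ground M) && ~~ indep X] C.

Arguments circuit : clear implicits.

Lemma restriction_simple (M : sbmatroid) (S : {set 'rV['F_2]_(ambient M)}) :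
  0 \notin ground M :&: S.
Proof. by rewrite inE (negbTE (ground_simple M)). Qed.

Definition restriction (M : sbmatroid) (S : {set 'rV['F_2]_(ambient M)}) :
  sbmatroid := SBMatroid (restriction_simple S).

Arguments restriction : clear implicits.

Definition isomorphic (M N : sbmatroid) : Prop :=
  exists f : 'rV['F_2]_(ambient M) -> 'rV['F_2]_(ambient N),
    [/\ {in ground M &, injective f},
        f @: ground M = ground N &
        forall X : {set 'rV['F_2]_(ambient M)},
          X \subset ground M -> indep (f @: X) = indep X].

Definition has_restriction (M N : sbmatroid) : Prop :=
  exists2 X : {set 'rV['F_2]_(ambient M)},
    X \subset ground M & isomorphic (restriction M X) N.

(* F, with 0 removed, is a flat of the geometry of M of rank r(M) - k; the
   additive form excludes k > r(M). *)
Definition codim_flat (M : sbmatroid) (k : nat)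
    (F : {vspace 'rV['F_2]_(ambient M)}) : Prop :=
  (F <= geometry M)%VS /\ (\dim F + k)%N = rank M.

Arguments codim_flat : clear implicits.

Definition codim_subspace (M : sbmatroid) (k : nat)
    (S : {set 'rV['F_2]_(ambient M)}) : Prop :=
  exists2 F : {vspace 'rV['F_2]_(ambient M)},
    codim_flat M k F & S = [set x in ground M | x \in F]%SET.

Arguments codim_subspace : clear implicits.

Definition has_disjoint_flat (M : sbmatroid) (c : nat) : Prop :=
  exists2 F : {vspace 'rV['F_2]_(ambient M)},
    codim_flat M c F & forall x, x \in ground M -> x \notin F.

Lemma has_disjoint_flat_ex (M : sbmatroid) :
  exists c, `[< has_disjoint_flat M c >].
Proof.
exists (rank M); apply/asboolP; exists 0%VS.
  by split; [rewrite sub0v | rewrite dimv0].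
move=> x xM; rewrite memv0; apply/eqP => x0.
by move: (ground_simple M); rewrite -x0 xM.
Qed.

Definition critical_number (M : sbmatroid) : nat :=
  ex_minn (has_disjoint_flat_ex M).

Definition threshold_set (R : realType) (N : sbmatroid) : set R :=
  fun alpha => 0 < alpha /\
    exists c' : nat, forall M : sbmatroid,
      ~ has_restriction M N ->
      alpha * 2 ^+ rank M <= #|ground M|%:R ->
      (critical_number M <= c')%N.

Arguments threshold_set : clear implicits.

Lemma card_ground_lt (M : sbmatroid) : (#|ground M| < 2 ^ rank M)%N.
Proof.
pose f x := [ffun i => coord (vbasis (geometry M)) i x].
have mem x : x \in 0 |: ground M -> x \in geometry M.
  by case/setU1P => [->|xM]; rewrite ?mem0v // memv_span ?mem_enum.
have finj : {in 0 |: ground M &, injective f}.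
  move=> x y /mem xM /mem yM /ffunP fxy.
  rewrite (coord_vbasis xM) (coord_vbasis yM).
  by apply: eq_bigr => i _; have := fxy i; rewrite !ffunE => ->.
have := max_card [in f @: (0 |: ground M)].
by rewrite card_in_imset // cardsU1 ground_simple card_ffun card_Fp // card_ord.
Qed.

(* Hence [inf], which is 0 by convention on ill-behaved sets, is the true
   infimum in the definition of the critical threshold. *)
Lemma has_inf_threshold_set (R : realType) (N : sbmatroid) :
  has_inf (threshold_set R N).
Proof.
split; last by exists 0 => alpha [/ltW].
exists 1; split => //; exists 0%N => M _.
by rewrite mul1r -natrX ler_nat leqNgt card_ground_lt.
Qed.

Definition critical_threshold (R : realType) (N : sbmatroid) : R :=
  inf (threshold_set R N).

Arguments critical_threshold : clear implicits.

Definition class_0 (N : sbmatroid) : Prop :=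
  critical_number N = 2%N /\
  exists S : {set 'rV['F_2]_(ambient N)},
    [/\ codim_subspace N 1 S, indep S &
        forall C : {set 'rV['F_2]_(ambient N)},
          circuit N C -> odd #|C| -> (4 <= #|C :&: (ground N :\: S)|)%N].

Definition class_14 (N : sbmatroid) : Prop :=
  [/\ critical_number N = 2%N, ~ class_0 N &
      exists2 S : {set 'rV['F_2]_(ambient N)}, codim_subspace N 1 S & indep S].

Definition class_12 (N : sbmatroid) : Prop :=
  [/\ critical_number N = 2%N, ~ class_0 N & ~ class_14 N].

(* Membership in the class indexed by delta; no class is attached to delta
   outside {0, 1/4, 1/2}. *)
Definition in_class (R : realType) (delta : R) (N : sbmatroid) : Prop :=
  [\/ delta = 0 /\ class_0 N,
      delta = 1 / 4 /\ class_14 N |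
      delta = 1 / 2 /\ class_12 N].

Definition has_subspace_in_class (R : realType) (N : sbmatroid) (k : nat)
    (delta : R) : Prop :=
  exists2 S : {set 'rV['F_2]_(ambient N)},
    codim_subspace N k S & in_class delta (restriction N S).

(* Main.v *)
(** Let [q = |N|] and fix [t]. Greedily one builds a set [X] of binary vectors
    without zero sums of at most [q] members that meets every subspace of
    codimension [t]: a random vector outside the few short sums meets a constant
    proportion of the subspaces not met so far. One may also ask that the last
    [k] coordinates of each member of [X] have at most [t] zeros, since every
    subspace of codimension [t] contains a vector with at most [t] zeros.

    Place [X] in a hyperplane [H] of a space [W], add a set [A] of vectors of
    [W] outside [H], and then all vectors outside [W] in a space in which [W]
    has codimension [c - 2]. The result has critical number above [t]. If it
    contains [N], then [W] cuts out of [N] a (c-2)-codimensional subspace [S]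
    with [H] cutting out an independent 1-codimensional subspace of [N|S], so
    [N|S] has critical number 2 and lies outside [N_{1/2}]; this contradicts the
    minimality of [delta = 1/2], with [A] everything outside [H]. For
    [delta = 0] take [A] empty: then [N|S] would be independent. For [delta = 1/4]
    let [A] be the vectors with somewhat more zeros than ones in the last [k]
    coordinates, about half of [W - H]: a sum of two of them has many zeros
    there, whereas an odd sum of at most [q] members of [X] has at most [q t].
    Hence odd circuits of [N|S] have at least four elements outside [H] and
    [N|S] is in [N_0]. *)

Require Import Defs.
From HB Require Import structures.
From mathcomp Require Import all_boot all_order all_algebra.
From mathcomp Require Import all_classical all_reals.
From mathcomp Require Import fintype finset.
From mathcomp Require Import zify ring lra.

Set Implicit Arguments.
Unset Strict Implicit.
Unset Printing Implicit Defensive.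

Import Order.TTheory GRing.Theory Num.Theory.
Local Open Scope ring_scope.

(** * Subset sums and independence over GF(2) *)

Lemma F2_eq1 (a : 'F_2) : (a != 0) = (a == 1).
Proof. by case: a => [[|[|[]]]]. Qed.

Lemma F2_oppr n (x : 'rV['F_2]_n) : - x = x.
Proof.
apply/eqP; rewrite eq_sym -addr_eq0; apply/eqP/rowP => i; rewrite !mxE.
by case: (x 0 i) => [[|[|[]]]] // h; apply/val_inj.
Qed.

Lemma F2_natr_odd j : j%:R = (odd j)%:R :> 'F_2.
Proof.
have h2 : 2%:R = 0 :> 'F_2 by apply/val_inj.
by rewrite -[in LHS](odd_double_half j) natrD -muln2 natrM h2 mulr0 addr0.
Qed.

(** Coefficients in ['F_2] are 0 or 1, so a linear relation is a zero sum over the vectors with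
    nonzero coefficient. *)
Lemma indepP n (X : {set 'rV['F_2]_n}) :
  reflect (forall T : {set 'rV['F_2]_n},
             T \subset X -> \sum_(x in T) x = 0 -> T = set0)
          (indep X).
Proof.
rewrite /indep; apply: (iffP idP) => [fX T sTX sT0|hX].
  have /freeP/(_ (fun i => ((enum X)`_i \in T)%:R)) := fX : free (in_tuple (enum X)).
  have -> : \sum_(i < size (enum X)) ((enum X)`_i \in T)%:R *: (in_tuple (enum X))`_i = 0.
    transitivity (\sum_(x <- enum X) (x \in T)%:R *: x).
      by rewrite (big_nth 0) big_mkord.
    rewrite -[RHS]sT0 big_enum /= (big_setID T) /= [X in _ + X]big1 ?addr0; last first.
      by move=> x /setDP[_ /negbTE->]; rewrite scale0r.
    by rewrite (setIidPr sTX); apply: eq_bigr => x ->; rewrite scale1r.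
  move=> /(_ erefl) h0; apply/eqP; rewrite -subset0; apply/subsetP => x xT.
  have xE : x \in enum X by rewrite mem_enum (subsetP sTX).
  have lti : (index x (enum X) < size (enum X))%N by rewrite index_mem.
  by have /= := h0 (Ordinal lti); rewrite nth_index // xT.
apply/(@freeP _ _ _ (in_tuple (enum X))) => k /= k0 i.
pose T := [set (enum X)`_j | j : 'I_(size (enum X)) & k j != 0]%SET.
have inj : injective (fun j : 'I_(size (enum X)) => (enum X)`_j).
  by move=> a b /eqP; rewrite nth_uniq ?enum_uniq // => /eqP/val_inj.
have TE : T = set0.
  apply: hX.
    by apply/subsetP => _ /imsetP[j _ ->]; rewrite -mem_enum mem_nth.
  rewrite big_imset /=; last by move=> a b _ _; apply: inj.
  rewrite -[RHS]k0 [RHS](bigID (fun j => k j != 0)) /= [X in _ = _ + X]big1.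
    rewrite addr0; apply: eq_big => [j|j]; rewrite inE // F2_eq1 => /eqP->.
    by rewrite scale1r.
  by move=> j /negPn/eqP->; rewrite scale0r.
apply/eqP; apply/negPn/negP => ki.
by have : (enum X)`_i \in T; [apply: imset_f; rewrite inE | rewrite TE inE].
Qed.

Lemma indepS n (X Y : {set 'rV['F_2]_n}) : X \subset Y -> indep Y -> indep X.
Proof.
by move=> sXY /indepP hY; apply/indepP => T sTX; apply/hY/(subset_trans sTX).
Qed.

Lemma circuit_sub (M : sbmatroid) C : circuit M C -> C \subset ground M.
Proof. by case/minsetP => /andP[]. Qed.

Lemma circuit_sum (M : sbmatroid) C : circuit M C -> \sum_(x in C) x = 0.
Proof.
case/minsetP => /andP[CM nC] minC.
have [T [sTC T0 Tn0]] : exists T : {set 'rV['F_2]_(ambient M)},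
   [/\ T \subset C, \sum_(x in T) x = 0 & T <> set0].
  apply: contrapT => h; move/indepP: nC; apply => T sTC T0.
  by apply: contrapT => Tn0; apply: h; exists T.
suff <- : T = C by [].
apply: minC => //; apply/andP; split; first exact: (subset_trans sTC).
by apply/indepP => /(_ T (subxx _) T0).
Qed.

(** * Restrictions of binary matroids as linear maps *)

Section ZeroSums.
Variables (m n : nat) (Y : {set 'rV['F_2]_n}) (h : 'rV['F_2]_n -> 'rV['F_2]_m).
Hypothesis h_inj : {in Y &, injective h}.
Hypothesis h_indep :
  forall T : {set 'rV['F_2]_n}, T \subset Y -> indep (h @: T) = indep T.

(** Split off a minimal zero sum, over a circuit [C]. The image of [C] contains a nonempty zero sum;
    the part of [C] mapped onto it is dependent by [h_indep], hence is all of [C]. Induction handles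
    the rest of [T]. *)
Lemma indep_preserving_sum0 (T : {set 'rV['F_2]_n}) :
  T \subset Y -> \sum_(x in T) x = 0 -> \sum_(x in T) h x = 0.
Proof.
have [k] := ubnP #|T|; elim: k T => // k IHk T leTk sTY sT0.
have [->|/eqP Tn0] := eqVneq T set0; first by rewrite big_set0.
pose P := [pred U : {set 'rV['F_2]_n} |
  [&& U != set0, U \subset T & \sum_(x in U) x == 0]].
have [C minC sCT] : {C : {set 'rV['F_2]_n} | minset P C & C \subset T}.
  by apply: minset_exists; rewrite /= subxx sT0 eqxx !andbT; apply/eqP.
case/minsetP: (minC) => /and3P[Cn0 _ /eqP sC0] {}minC.
have sCY := subset_trans sCT sTY.
have : ~~ indep (h @: C).
  by rewrite h_indep //; apply/indepP => /(_ C (subxx _) sC0)/eqP; apply/negP.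
move/indepP => hC; have [U [sUhC U0 Un0]] : exists U : {set 'rV['F_2]_m},
   [/\ U \subset h @: C, \sum_(x in U) x = 0 & U <> set0].
  apply: contrapT => hh; apply: hC => U sUhC U0.
  by apply: contrapT => Un0; apply: hh; exists U.
pose U' := C :&: h @^-1: U.
have sU'C : U' \subset C by apply: subsetIl.
have UE : U = h @: U'.
  apply/setP => u; apply/idP/imsetP => [uU|[x /setIP[_]]]; last by rewrite inE => ? ->.
  by have /imsetP[x xC ux] := subsetP sUhC u uU; exists x; rewrite // !inE xC -ux.
move: (U') sU'C UE => {}U' sU'C UE; rewrite {}UE in U0 Un0.
have sU'Y := subset_trans sU'C sCY.
have: ~~ indep (h @: U') by apply/indepP => /(_ _ (subxx _) U0).
rewrite h_indep // => /indepP hU'.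
have [V [sVU' V0 Vn0]] : exists V : {set 'rV['F_2]_n},
   [/\ V \subset U', \sum_(x in V) x = 0 & V <> set0].
  apply: contrapT => hh; apply: hU' => V sVU' V0.
  by apply: contrapT => Vn0; apply: hh; exists V.
have VC : V = C.
  have sVC := subset_trans sVU' sU'C.
  apply: minC => //=; apply/and3P; split; [exact/eqP | | exact/eqP].
  exact: (subset_trans sVC).
have UC : U' = C by apply/eqP; rewrite eqEsubset sU'C -VC.
have hC0 : \sum_(x in C) h x = 0.
  by rewrite -UC -[RHS]U0 big_imset // => a b aU bU; apply: h_inj;
    apply: (subsetP sU'Y).
move: sT0; rewrite (big_setID C) (big_setID C (A := T)) /= !(setIidPr sCT) sC0 hC0 !add0r.
apply: IHk; last by apply: subset_trans sTY; apply: subsetDl.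
rewrite -ltnS; apply: leq_trans leTk; rewrite ltnS; apply: proper_card.
by rewrite properEneq subsetDl andbT; apply: contraNneq Cn0 => /setDidPl;
   rewrite -setI_eq0 (setIidPr sCT).
Qed.

(* The zero sums of [Y] say that the row kernel of the matrix with rows [y]
   is contained in that of the matrix with rows [h y]. *)
Lemma indep_preserving_linear :
  exists g : 'Hom('rV['F_2]_n, 'rV['F_2]_m), {in Y, g =1 h}.
Proof.
pose s := enum Y.
pose A := \matrix_(i < size s) s`_i.
pose B := \matrix_(i < size s) h s`_i.
have ker (c : 'rV['F_2]_(size s)) : c *m A = 0 -> c *m B = 0.
  pose T := [set s`_j | j : 'I_(size s) & c 0 j != 0]%SET.
  have inj : injective (fun j : 'I_(size s) => s`_j).
    by move=> a b /eqP; rewrite nth_uniq ?enum_uniq // => /eqP/val_inj.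
  have sumE p (F : 'rV['F_2]_n -> 'rV['F_2]_p) :
      \sum_(x in T) F x = c *m (\matrix_(i < size s) F s`_i).
    rewrite big_imset /=; last by move=> a b _ _; apply: inj.
    rewrite mulmx_sum_row [RHS](bigID (fun j => c 0 j != 0)) /= [X in _ = _ + X]big1.
      rewrite addr0; apply: eq_big => [j|j]; rewrite inE // F2_eq1 => /eqP->.
      by rewrite scale1r rowK.
    by move=> j /negPn/eqP->; rewrite scale0r.
  rewrite -(sumE _ id) -(sumE _ h); apply: indep_preserving_sum0.
  by apply/subsetP => _ /imsetP[j _ ->]; rewrite -mem_enum mem_nth.
(* [y *m pinvmx A] writes [y] as some combination of rows of [A]; its difference from the unit
   vector of the row [y] lies in the row kernel of [A], where [ker] applies. *)
exists (linfun (mulmxr (pinvmx A *m B))) => y yY; rewrite lfunE /= mulmxA.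
have yE : y \in s by rewrite mem_enum.
have lti : (index y s < size s)%N by rewrite index_mem.
have rA : row (Ordinal lti) A = y by rewrite rowK /= nth_index.
have -> : h y = row (Ordinal lti) B by rewrite rowK /= nth_index.
apply/eqP; rewrite -subr_eq0 rowE -mulmxBl; apply/eqP/ker.
by rewrite mulmxBl -rowE rA mulmxKpV ?subrr // -rA row_sub.
Qed.

End ZeroSums.

(** Binary matroids are uniquely representable: the inverse of the isomorphism preserves
    independence, so it extends to a linear map of ambient spaces, along which subspaces can be
    pulled back. *)
Lemma has_restriction_linear (M N : sbmatroid) : has_restriction M N ->
  exists g : 'Hom('rV['F_2]_(ambient N), 'rV['F_2]_(ambient M)),
    {in ground N &, injective g} /\ {in ground N, forall x, g x \in ground M}.
Proof.
case=> X sXM [f [f_inj f_im f_indep]].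
have ex y : exists x, y \in ground N -> x \in ground M :&: X /\ f x = y.
  have [|_] := boolP (y \in ground N); last by exists 0.
  by rewrite -f_im => /imsetP[x xX ->]; exists x.
have [h hE] := choice ex.
have hK : {in ground N, cancel h f} by move=> y /hE[].
have h_inj : {in ground N &, injective h} by apply: can_in_inj hK.
have [T sTN|g gh] := indep_preserving_linear h_inj.
  have hT : h @: T \subset ground (restriction M X).
    by apply/subsetP => _ /imsetP[y yT ->]; case: (hE y (subsetP sTN _ yT)).
  rewrite -(f_indep (h @: T)) // -imset_comp.
  suff -> : [set (f \o h) x | x in T]%SET = T by [].
  rewrite -[RHS]imset_id; apply: eq_in_imset => x xT /=.
  exact/hK/(subsetP sTN).
exists g; split => [x y xN yN|x xN].
  by rewrite !gh //; apply: h_inj.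
by rewrite gh //; case: (hE x xN) => /setIP[].
Qed.

(** * Codimension and critical number in the ambient space *)

Lemma dim_rV n : \dim {:'rV['F_2]_n} = n.
Proof. by rewrite dimvf dim_matrix mul1r. Qed.

Lemma dim_rV_le n (F : {vspace 'rV['F_2]_n}) : (\dim F <= n)%N.
Proof. by rewrite -[leqRHS]dim_rV dimvS ?subvf. Qed.

Lemma leq_dim_cap n (F G : {vspace 'rV['F_2]_n}) :
  (\dim F + \dim G <= \dim (F :&: G) + n)%N.
Proof. by rewrite -dimv_sum_cap addnC leq_add2l dim_rV_le. Qed.

Lemma leq_dim_lker n m (f : 'Hom('rV['F_2]_n, 'rV['F_2]_m)) :
  (n <= \dim (lker f) + m)%N.
Proof. by rewrite -[leqLHS]dim_rV -(limg_ker_dim f fullv) capfv leq_add2l dim_rV_le. Qed.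

(** The preimage is the kernel of [p \o f], where [p] has kernel [F] and so an image of dimension
    [m - \dim F]. *)
Lemma leq_dim_lpreim n m (f : 'Hom('rV['F_2]_n, 'rV['F_2]_m)) F :
  (n + \dim F <= \dim (f @^-1: F) + m)%N.
Proof.
pose p : 'End('rV['F_2]_m) := \1%VF - projv F.
have pK : lker p = F.
  apply/vspaceP => x; rewrite memv_ker /p add_lfunE opp_lfunE id_lfunE subr_eq0.
  apply/eqP/idP => [->|xF]; first exact: memv_proj.
  by rewrite projv_id.
have -> : (f @^-1: F = lker (p \o f))%VS.
  by apply/vspaceP => x; rewrite -memv_preim memv_ker comp_lfunE -memv_ker pK.
have := limg_ker_dim (p \o f)%VF fullv; rewrite capfv dim_rV limg_comp => nE.
rewrite -{1}nE -addnA leq_add2l.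
have := limg_ker_dim p fullv; rewrite capfv dim_rV pK => mE.
by rewrite -[leqRHS]mE addnC leq_add2l dimvS // limgS // subvf.
Qed.

Lemma subspace_of_dim (K : fieldType) (vT : vectType K) (U : {vspace vT}) k :
  (k <= \dim U)%N -> exists2 F : {vspace vT}, (F <= U)%VS & \dim F = k.
Proof.
move=> lek; exists <<take k (vbasis U)>>%VS.
  by apply/span_subvP => x /mem_take/vbasis_mem.
have := basis_free (vbasisP U); rewrite -{1}(cat_take_drop k (vbasis U)).
by move=> /catl_free/eqP->; rewrite size_take size_tuple; case: ltngtP lek.
Qed.

(** Flats live in the span of the ground set, the construction in the ambient space. Adding to [F] a
    complement of the span keeps both the codimension and the trace on the span. *)
Lemma codim_flat_lift M k F : codim_flat M k F ->
  exists2 G : {vspace 'rV['F_2]_(ambient M)}, (ambient M <= \dim G + k)%N &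
    forall x, x \in geometry M -> x \in G -> x \in F.
Proof.
move=> [FV dimF]; set V := geometry M in FV *.
have FC0 : (F :&: V^C = 0)%VS.
  by apply/eqP; rewrite -subv0 -(capv_compl V) capvS.
exists (F + V^C)%VS.
  rewrite dimv_disjoint_sum // dimv_compl dim_rV.
  by have := dim_rV_le V; move: dimF; rewrite /rank -/V; lia.
move=> x xV /memv_addP[f fF [w wC xE]].
suff w0 : w = 0 by rewrite xE w0 addr0.
apply/eqP; rewrite -memv0 -(capv_compl V) memv_cap wC andbT.
by rewrite -[w](addKr f) -xE addrC memvB // (subvP FV).
Qed.

(** The trace of [G] on the span can have codimension below [k], so a subspace of it is chosen. *)
Lemma codim_flat_sub M k (G : {vspace 'rV['F_2]_(ambient M)}) :
  (ambient M <= \dim G + k)%N -> (k <= rank M)%N ->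
  exists2 F, codim_flat M k F & (F <= G)%VS.
Proof.
move=> dimG lek; have := leq_dim_cap G (geometry M); rewrite -/(rank M) => dimGV.
have [|F FGV dimF] := @subspace_of_dim _ _ (G :&: geometry M)%VS (rank M - k).
  by lia.
exists F; last exact: subv_trans FGV (capvSl _ _).
by split; [exact: subv_trans FGV (capvSr _ _) | rewrite dimF; lia].
Qed.

Lemma ground_geometry M x : x \in ground M -> x \in geometry M.
Proof. by move=> xM; apply: memv_span; rewrite mem_enum. Qed.

Lemma critical_number_flat M : has_disjoint_flat M (critical_number M).
Proof. by rewrite /critical_number; case: ex_minnP => c /asboolP. Qed.

(** With codimension taken in the ambient space and only bounded, critical numbers can be estimated
    by intersecting subspaces. *)
Lemma critical_number_leP M k :
  reflect (exists2 F : {vspace 'rV['F_2]_(ambient M)},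
             (ambient M <= \dim F + k)%N & forall x, x \in ground M -> x \notin F)
          (critical_number M <= k)%N.
Proof.
apply: (iffP idP) => [lek|[F dimF disjF]].
  have [F /codim_flat_lift[G dimG GF] disjF] := critical_number_flat M.
  exists G => [|x xM]; first by lia.
  by apply: contra (disjF x xM); apply/GF/ground_geometry.
have := leq_dim_cap F (geometry M); rewrite -/(rank M) => dimFV.
rewrite /critical_number; case: ex_minnP => c _ minc.
apply: (@leq_trans (rank M - \dim (F :&: geometry M)%VS)); last by lia.
apply: minc; apply/asboolP; exists (F :&: geometry M)%VS => [|x xM].
  split; first exact: capvSr.
  by rewrite subnKC // dimvS ?capvSr.
by rewrite memv_cap negb_and disjF.
Qed.

Lemma critical_number_le_rank M : (critical_number M <= rank M)%N.
Proof. by have [F [_ <-] _] := critical_number_flat M; rewrite leq_addl. Qed.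

(** The functional adding up the coordinates with respect to [X] is 1 on each member of [X]; its
    kernel is the subspace. *)
Lemma indep_avoid n (X : {set 'rV['F_2]_n}) : indep X ->
  exists2 F : {vspace 'rV['F_2]_n}, (n <= \dim F + 1)%N &
    forall x, x \in X -> x \notin F.
Proof.
rewrite /indep => fX; pose b := in_tuple (enum X).
pose f v : 'rV['F_2]_1 := \row_(_ < 1) \sum_(i < size (enum X)) coord b i v.
have lf : linear f.
  move=> a u v; apply/rowP => j; rewrite !mxE mulr_sumr -big_split /=.
  by apply: eq_bigr => i _; rewrite linearP.
pose fL := GRing.isLinear.Build _ _ _ _ f lf.
pose fl : {linear 'rV['F_2]_n -> 'rV['F_2]_1} := HB.pack f fL.
exists (lker (linfun fl)); first exact: leq_dim_lker.
move=> x xX; rewrite memv_ker lfunE /=.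
have xE : x \in enum X by rewrite mem_enum.
have lti : (index x (enum X) < size (enum X))%N by rewrite index_mem.
have [i xb] : exists i : 'I_(size (enum X)), x = b`_i.
  by exists (Ordinal lti); rewrite /= nth_index.
apply/eqP => /rowP/(_ ord0); rewrite !mxE (bigD1 i) //= big1.
  by rewrite xb coord_free // eqxx.
by move=> j neqj; rewrite xb coord_free // eq_sym (negbTE neqj).
Qed.

(** Inside [H] the set [S] is independent, hence avoided by a second hyperplane; the two together
    give critical number at most 2. The value of [c] excludes anything smaller. *)
Lemma codim_subspace_indep M c (F0 H : {vspace 'rV['F_2]_(ambient M)}) :
  critical_number M = c -> (2 <= c)%N ->
  (ambient M <= \dim F0 + (c - 2))%N -> (ambient M <= \dim H + 1)%N ->
  indep [set x in ground M | (x \in F0) && (x \in H)] ->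
  exists S, [/\ codim_subspace M (c - 2) S,
    {subset S <= [set x in ground M | x \in F0]},
    critical_number (restriction M S) = 2%N,
    codim_subspace (restriction M S) 1 [set x in S | x \in H] &
    indep [set x in S | x \in H]].
Proof.
move=> critM c2 dimF0 dimH indH.
have [|F codF FF0] := codim_flat_sub dimF0.
  by rewrite (leq_trans (leq_subr _ _)) // -critM critical_number_le_rank.
pose S := [set x in ground M | x \in F]; exists S.
have sSM : S \subset ground M by apply/subsetP => x; rewrite inE => /andP[].
have gS : ground (restriction M S) = S by apply/setIidPr.
have indS' : indep [set x in S | x \in H].
  apply: indepS indH; apply/subsetP => x; rewrite !inE -andbA => /and3P[-> xF ->].
  by rewrite (subvP FF0).
have crit2 : critical_number (restriction M S) = 2%N.
  apply/eqP; rewrite eqn_leq; apply/andP; split.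
    have [G dimG disjG] := indep_avoid indS'.
    apply/critical_number_leP; exists (G :&: H)%VS => [|x].
      by have := leq_dim_cap G H; rewrite /=; lia.
    rewrite gS memv_cap => xS; apply/negP => /andP[xG xH].
    by move: xG; apply/negP/disjG; rewrite inE xS.
  (* A hyperplane avoiding [S] and the lift of [F] would meet in codimension at most [c - 1], off
     the ground set of [M]. *)
  rewrite ltnNge; apply/negP => /critical_number_leP[G dimG disjG].
  have [F' dimF' F'F] := codim_flat_lift codF.
  suff : (critical_number M <= c - 1)%N by rewrite critM; lia.
  apply/critical_number_leP; exists (F' :&: G)%VS => [|x xM].
    by have := leq_dim_cap F' G; rewrite /= in dimG *; lia.
  rewrite memv_cap; apply/negP => /andP[xF' xG].
  move: xG; apply/negP/disjG; rewrite gS inE xM /=.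
  exact: F'F (ground_geometry xM) xF'.
split => //; first by exists F.
  by move=> x; rewrite !inE => /andP[-> /(subvP FF0)].
exists (H :&: geometry (restriction M S))%VS.
  split; first exact: capvSr.
  have := leq_dim_cap H (geometry (restriction M S)).
  have := dimvS (capvSr H (geometry (restriction M S))).
  (* If [H] contained the span of [S], then [S] would be independent and of critical number at most
     1. *)
  rewrite -/(rank (restriction M S)) leq_eqVlt => /orP[/eqP e _|]; last first.
    by rewrite /= in dimH *; lia.
  have gH : (geometry (restriction M S) <= H)%VS.
    by apply/capv_idPr/eqP; rewrite eqEdim capvSr e leqnn.
  have indS : indep S.
    apply: indepS indS'; apply/subsetP => x xS; rewrite inE xS (subvP gH) //.
    by apply: ground_geometry; rewrite gS.
  have [G dimG disjG] := indep_avoid indS.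
  suff : (critical_number (restriction M S) <= 1)%N by rewrite crit2.
  by apply/critical_number_leP; exists G => // x; rewrite gS => /disjG.
rewrite gS; apply/setP => x; rewrite [LHS]in_set [RHS]in_set memv_cap.
case xS: (x \in S) => //=; suff -> : x \in geometry (restriction M S) by rewrite andbT.
by apply: ground_geometry; rewrite gS.
Qed.

(** * Dense matroids of large critical number *)

Definition hits t n (X : {set 'rV['F_2]_n}) :=
  forall F : {vspace 'rV['F_2]_n}, (n <= \dim F + t)%N ->
  exists2 x, x \in X & x \in F.

Definition sum_free q n (X : {set 'rV['F_2]_n}) :=
  forall T : {set 'rV['F_2]_n},
    T \subset X -> (#|T| <= q)%N -> \sum_(x in T) x = 0 -> T = set0.

(** [X] is placed in a subspace of codimension [d] and a copy of [A] in each of its other cosets.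
    Both layers of the construction have this form: [d = 1] for [H] in [W], and [d = c - 2] with
    [A = setT] for [W] in the whole space. *)
Definition ext d n (X A : {set 'rV['F_2]_n}) : {set 'rV['F_2]_(d + n)} :=
  [set x | if lsubmx x == 0 then rsubmx x \in X else rsubmx x \in A].

Lemma eq_lrsubmx (T : Type) m d n (x y : 'M[T]_(m, d + n)) :
  lsubmx x = lsubmx y -> rsubmx x = rsubmx y -> x = y.
Proof. by move=> xl xr; rewrite -(hsubmxK x) -(hsubmxK y) xl xr. Qed.

Lemma card_rV n : #|{: 'rV['F_2]_n}| = (2 ^ n)%N.
Proof. by rewrite card_mx card_Fp // mul1n. Qed.

Lemma card_ext d n (X A : {set 'rV['F_2]_n}) :
  #|ext d X A| = (#|X| + (2 ^ d - 1) * #|A|)%N.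
Proof.
have -> : ext d X A = [set row_mx p.1 p.2 | p in
    setX [set (0 : 'rV_d)] X :|: setX [set~ (0 : 'rV_d)] A].
  apply/setP => x; rewrite inE; apply/idP/imsetP => [xE|[[u v]]].
    exists (lsubmx x, rsubmx x); last by rewrite hsubmxK.
    by move: xE; rewrite !inE /=; case: (lsubmx x == 0) => /= ->.
  by rewrite !inE /= => + ->; rewrite row_mxKl row_mxKr; case: (u == 0); rewrite ?orbF.
rewrite card_imset; last first.
  by move=> [a b] [a' b'] /= /eq_row_mx[-> ->].
rewrite cardsU !cardsX cards1 mul1n cardsC1 card_rV subn1.
rewrite (_ : _ :&: _ = set0) ?cards0 ?subn0 //.
by apply/setP => -[u v]; rewrite !inE /=; case: eqP => //=; rewrite andbF.
Qed.

Lemma hits_ext d t n (X A : {set 'rV['F_2]_n}) : hits t X -> hits t (ext d X A).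
Proof.
move=> hX F dimF; pose i := linfun (mulmxr (row_mx (0 : 'M['F_2]_(n, d)) 1%:M) : 'rV_n -> _).
have iE x : i x = row_mx 0 x by rewrite lfunE /= mul_mx_row mulmx0 mulmx1.
have [|x xX] := hX (i @^-1: F)%VS.
  have := leq_dim_lpreim i F; move: dimF; set a := \dim F; set b := \dim (i @^-1: F)%VS; lia.
rewrite -memv_preim iE => xF; exists (row_mx 0 x) => //.
by rewrite inE row_mxKl eqxx row_mxKr.
Qed.

(* How a matroid [N] of critical number [c] is placed in
   [ext (c - 2) (ext 1 X A) setT]. *)
Definition embedded N c n (X A : {set 'rV['F_2]_n})
    (S : {set 'rV['F_2]_(ambient N)})
    (g : 'Hom('rV['F_2]_(ambient N), 'rV['F_2]_(1 + n))) : Prop :=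
  let H := [set x in S | lsubmx (g x) == 0] in
  [/\ codim_subspace N (c - 2) S, critical_number (restriction N S) = 2%N,
      codim_subspace (restriction N S) 1 H, indep H &
      {in S &, injective g} /\ {in S, forall x, g x \in ext 1 X A}].

(** The kernel of [l0] is the part of [N] over [W], that of [l] the part over [H]. On both, [u] maps
    injectively into [X], so a zero sum there becomes one of at most [#|ground N|] members of [X]
    and must be empty. Hence [codim_subspace_indep] applies. *)
Lemma has_restriction_embedded N c n (X A : {set 'rV['F_2]_n}) M0 :
  critical_number N = c -> (2 <= c)%N -> sum_free #|ground N| X ->
  has_restriction (@SBMatroid _ (ext (c - 2) (ext 1 X A) setT) M0) N ->
  exists S g, @embedded N c n X A S g.
Proof.
move=> critN c2 sfX /has_restriction_linear[g0 []] /=.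
set d := (c - 2)%N in g0 * => inj0 im0.
pose g := (linfun (@rsubmx _ 1 d (1 + n)) \o g0)%VF.
have gE x : g x = rsubmx (g0 x) by rewrite comp_lfunE lfunE.
pose l0 := (linfun (@lsubmx _ 1 d (1 + n)) \o g0)%VF.
have l0E x : l0 x = lsubmx (g0 x) by rewrite comp_lfunE lfunE.
pose l := (linfun (@lsubmx 'F_2 1 1 n) \o g)%VF.
have lE x : l x = lsubmx (g x) by rewrite comp_lfunE lfunE.
pose u := (linfun (@rsubmx 'F_2 1 1 n) \o g)%VF.
have uE x : u x = rsubmx (g x) by rewrite comp_lfunE lfunE.
clearbody l0 l u; clearbody g.
have gX x : x \in ground N -> x \in lker l0 -> g x \in ext 1 X A.
  rewrite memv_ker l0E gE => /im0/= + x0.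
  by rewrite in_set x0.
have g_inj : {in [set x in ground N | x \in lker l0] &, injective g}.
  move=> x y; rewrite !in_set !memv_ker !l0E => /andP[xN /eqP x0] /andP[yN /eqP y0].
  by rewrite !gE => gxy; apply: inj0 => //; apply: eq_lrsubmx gxy; rewrite x0 y0.
have [|S [codS sS crit2 codS' indS']] :=
  @codim_subspace_indep N c (lker l0) (lker l) critN c2 (leq_dim_lker _) (leq_dim_lker _).
  apply/indepP => T sT T0; apply/eqP; rewrite -(imset_eq0 u); apply/eqP.
  have sTE x : x \in T -> [/\ x \in ground N, x \in lker l0 & x \in lker l].
    by move/(subsetP sT); rewrite in_set => /and3P[].
  apply: sfX.
  - apply/subsetP => _ /imsetP[x /sTE[xN x0 xl] ->].
    by have := gX x xN x0; rewrite in_set uE -lE -memv_ker xl.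
  - apply: leq_trans (leq_imset_card _ _) (subset_leq_card _).
    by apply/subsetP => x /sTE[].
  - rewrite big_imset /=; first by rewrite -linear_sum T0 linear0.
    move=> x y /sTE[xN x0 xl] /sTE[yN y0 yl]; rewrite !uE => uxy.
    have l_0 z : z \in lker l -> lsubmx (g z) = 0 by rewrite memv_ker lE => /eqP.
    have gxy : g x = g y.
      by apply: eq_lrsubmx uxy; rewrite (l_0 x xl) (l_0 y yl).
    by apply: g_inj gxy; rewrite in_set ?xN ?yN ?x0 ?y0.
exists S, g; rewrite /embedded.
have <- : [set x in S | x \in lker l] = [set x in S | lsubmx (g x) == 0].
  by apply/setP => x; rewrite !in_set memv_ker lE.
split => //; split => [x y /sS xS /sS yS|x /sS]; first exact: g_inj.
by rewrite in_set => /andP[]; apply: gX.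
Qed.

(** If some [alpha] below the bound were in the threshold set, with critical numbers bounded by [t],
    a set [X] made for this [t] would give a matroid without restriction [N] that is dense enough
    but has critical number above [t]. *)
Lemma critical_threshold_ge (R : realType) N c (beta : R) :
  critical_number N = c -> (2 <= c)%N ->
  (forall (e : R) t, 0 < e -> exists n (X A : {set 'rV['F_2]_n}),
    [/\ hits t X, sum_free #|ground N|.+1 X,
      (beta - e) * 2 ^+ (1 + n) <= #|A|%:R &
      forall S g, ~ @embedded N c n X A S g]) ->
  1 - (1 - beta) * 2 ^- (c - 2) <= critical_threshold R N.
Proof.
move=> critN c2 hyp; apply: lb_le_inf; first by case: (has_inf_threshold_set R N).
move=> alpha [alpha0 [t ht]]; rewrite leNgt; apply/negP => lt_alpha.
set d := (c - 2)%N in lt_alpha *.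
have d0 : 0 < 2 ^+ d :> R by rewrite exprn_gt0.
(* With this [e], the density [1 - (1 - beta + e) 2^-d] guaranteed by the construction is exactly
   [alpha]. *)
pose e := (1 - (1 - beta) * 2 ^- d - alpha) * 2 ^+ d.
have [|n [X [A [hX sfX cardA nemb]]]] := hyp e t.
  by rewrite mulr_gt0 // subr_gt0.
have M0 : 0 \notin ext d (ext 1 X A) setT.
  rewrite inE !linear0 eqxx inE !linear0 eqxx; apply/negP => X0.
  (* The zero vector would be a zero sum of one term, and the successor in the bound on the number
     of terms always allows one. *)
  have := sfX [set 0]; rewrite sub1set X0 cards1 big_set1 => /(_ erefl erefl erefl).
  by move/eqP; rewrite -cards_eq0 cards1.
pose M := SBMatroid M0.
have : (critical_number M <= t)%N.
  apply: ht => [/has_restriction_embedded|].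
    case=> // [T sTX leT|S [g]]; last exact: nemb.
    by apply: sfX => //; apply: leqW.
  apply: (@le_trans _ _ (alpha * 2 ^+ (d + (1 + n)))).
    by rewrite ler_wpM2l ?(ltW alpha0) // ler_weXn2l ?ler1n // dim_rV_le.
  rewrite /= !card_ext cardsT card_rV !natrD natrM natrB ?expn_gt0 // !natrX.
  rewrite [2 ^+ (d + _)]exprD mulrA.
  have -> : alpha * 2 ^+ d = 2 ^+ d - (1 - beta) - e.
    by rewrite /e; field; rewrite gt_eqF.
  have : 0 <= #|X|%:R :> R by [].
  have : #|A|%:R <= (2 ^ 1 - 1)%:R * #|A|%:R :> R by rewrite mul1r.
  nra.
move=> /(@critical_number_leP M t)[F dimF disjF].
have [x xM xF] := hits_ext (d := d) setT (hits_ext (d := 1) A hX) dimF.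
by move: (disjF x xM); rewrite xF.
Qed.

(** * Greedy choice of a transversal *)

(** By averaging, some allowed point meets a proportion [1/L] of the indices still unmet. After [m]
    rounds at most [#|D| (1 - 1/L)^m < 1] indices remain. *)
Lemma greedy_transversal (V I : finType) (D : {set I}) (r : I -> V -> bool)
    (P : {set V} -> Prop) (allowed : {set V} -> {set V}) (L m : nat) :
  (0 < L)%N -> (0 < #|V|)%N -> P set0 ->
  (forall Y v, P Y -> v \in allowed Y -> P (v |: Y)) ->
  (forall Y i, P Y -> (#|Y| < m)%N -> i \in D ->
     (#|V| <= L * #|[set v in allowed Y | r i v]|)%N) ->
  (#|D| * (L - 1) ^ m < L ^ m)%N ->
  exists2 Y : {set V}, P Y & forall i, i \in D -> exists2 v, v \in Y & r i v.
Proof.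
move=> L0 V0 P0 Pstep hyp small.
pose U (Y : {set V}) := [set i in D | [forall v in Y, ~~ r i v]].
have step Y : P Y -> (#|Y| < m)%N ->
    exists2 Y', P Y' /\ (#|Y'| <= #|Y|.+1)%N & (L * #|U Y'| <= (L - 1) * #|U Y|)%N.
  move=> PY ltY; have [U0|/set0Pn[i0 i0U]] := eqVneq (U Y) set0.
    by exists Y; rewrite // U0 cards0 !muln0.
  pose hit v := #|[set i in U Y | r i v]|.
  have [v vA hitv] : exists2 v, v \in allowed Y & (#|U Y| <= L * hit v)%N.
    apply/exists_inP; apply: contraT; rewrite negb_exists_in => /forall_inP lth.
    have UD i : i \in U Y -> i \in D by rewrite inE => /andP[].
    (* Double counting of the pairs of an unmet index and an allowed point meeting it. *)
    have le1 : (#|U Y| * #|V| <= \sum_(v in allowed Y) L * hit v)%N.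
      rewrite -big_distrr /= -sum_nat_const.
      rewrite (eq_bigr (fun v => \sum_(i in U Y) (r i v : nat))%N); last first.
        move=> v _; rewrite /hit -sum1_card big_mkcond [RHS]big_mkcond /=.
        by apply: eq_bigr => i _; rewrite in_set; case: (i \in U Y) => //=; case: (r i v).
      rewrite exchange_big big_distrr /=; apply: leq_sum => i iU.
      apply: leq_trans (hyp Y i PY ltY (UD i iU)) _; rewrite leq_mul2l; apply/orP; right.
      rewrite -sum1_card big_mkcond [leqRHS]big_mkcond /=.
      by apply: leq_sum => v _; rewrite in_set; case: (v \in allowed Y) => //=; case: (r i v).
    (* An allowed point must exist for the termwise strict inequalities to add up to a strict
       one. *)
    have [v0 v0A] : exists v, v \in allowed Y.
      have := hyp Y i0 PY ltY (UD i0 i0U).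
      have [->|/set0Pn[v]] := eqVneq [set v in allowed Y | r i0 v] set0.
        by rewrite cards0 muln0 leqn0 => /eqP V00; rewrite V00 in V0.
      by rewrite inE => /andP[vA _]; exists v.
    have : (\sum_(v in allowed Y) L * hit v < \sum_(v in allowed Y) #|U Y|)%N.
      rewrite (bigD1 v0) //= [ltnRHS](bigD1 v0) //= -addSn leq_add //.
        by rewrite ltnNge lth.
      by apply: leq_sum => v /andP[vA _]; rewrite ltnW // ltnNge lth.
    rewrite sum_nat_const ltnNge => /negP[]; apply: leq_trans le1.
    by rewrite mulnC leq_mul2l max_card orbT.
  exists (v |: Y).
    by split; [exact: Pstep | rewrite cardsU1 -add1n leq_add2r leq_b1].
  have -> : U (v |: Y) = U Y :\: [set i in U Y | r i v].
    apply/setP => i; rewrite !inE; case: (i \in D) => //=.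
    apply/forall_inP/andP => [h|[+ /forall_inP h] w].
      have h' : [forall w in Y, ~~ r i w].
        by apply/forall_inP => w wY; rewrite h // inE wY orbT.
      by rewrite h' /=; split=> //; apply: h; rewrite setU11.
    have -> : [forall w in Y, ~~ r i w] by apply/forall_inP.
    by rewrite /= => rv; rewrite !inE => /orP[/eqP->|/h].
  rewrite cardsD (setIidPr _); last by apply/subsetP => i; rewrite inE => /andP[].
  by move: hitv; rewrite /hit mulnBl mulnBr mul1n; lia.
have main j : (j <= m)%N -> exists2 Y, P Y /\ (#|Y| <= j)%N &
    (#|U Y| * L ^ j <= #|D| * (L - 1) ^ j)%N.
  elim: j => [_|j IHj ltj].
    exists set0; first by rewrite cards0.
    by rewrite !muln1 subset_leq_card //; apply/subsetP => i; rewrite inE => /andP[].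
  have [Y [PY leY] leU] := IHj (ltnW ltj).
  have [|Y' [PY' leY'] leU'] := step Y PY; first exact: leq_ltn_trans leY ltj.
  exists Y'; first by split => //; apply: leq_trans leY' _.
  rewrite !expnS mulnA [(_ * L)%N]mulnC; apply: leq_trans (leq_mul leU' (leqnn _)) _.
  by rewrite -mulnA [leqRHS]mulnCA leq_mul2l leU orbT.
have [Y [PY _] leU] := main m (leqnn m); exists Y => // i iD.
apply/exists_inP; apply: contraT; rewrite negb_exists_in => hi.
have iU : i \in U Y by rewrite inE iD.
have := leq_ltn_trans leU small; rewrite -[ltnRHS]mul1n ltn_mul2r ltnS leqn0 cards_eq0.
by case/andP => _ /eqP U0; rewrite U0 inE in iU.
Qed.

(** * Vectors with few zeros, short sums, and the set [X] *)

Definition zeros n (b : 'rV['F_2]_n) : {set 'I_n} := [set i | b 0 i == 0].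

(** If [F] contains all unit vectors it contains the all-ones vector. Otherwise adjoin a missing
    unit vector, which lowers the codimension; returning to [F] changes one coordinate only, at the
    cost of at most one zero. *)
Lemma few_zeros n t (F : {vspace 'rV['F_2]_n}) : (n <= \dim F + t)%N ->
  exists2 b, b \in F & (#|zeros b| <= t)%N.
Proof.
elim: t F => [|t IHt] F dimF.
  have -> : F = fullv.
    by apply/eqP; rewrite eqEdim subvf dim_rV; rewrite addn0 in dimF.
  exists (const_mx 1); first exact: memvf.
  by rewrite leqn0 cards_eq0; apply/eqP/setP => i; rewrite !inE mxE.
have [/forallP full|] := boolP [forall i, delta_mx 0 i \in F].
  exists (const_mx 1).
    by rewrite [const_mx _]row_sum_delta; apply: memv_suml => i _; rewrite memvZ.
  suff -> : zeros (const_mx 1 : 'rV['F_2]_n) = set0 by rewrite cards0.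
  by apply/setP => i; rewrite !inE mxE.
rewrite negb_forall => /existsP[j jF]; set e := delta_mx 0 j in jF.
have [|b /memv_addP[f fF [_ /vlineP[a ->] bE]] bz] := IHt (F + <[e]>)%VS.
  have e0 : (F :&: <[e]> = 0)%VS.
    apply/eqP; rewrite -subv0; apply/subvP => x /memv_capP[xF /vlineP[a xE]].
    move: xF; rewrite xE memv0; have [->|] := eqVneq a 0; first by rewrite scale0r.
    by rewrite F2_eq1 => /eqP->; rewrite scale1r (negbTE jF).
  rewrite dimv_disjoint_sum // dim_vline; suff -> : e != 0 by lia.
  by apply: contraNneq jF => ->; rewrite mem0v.
exists f => //; apply: (@leq_trans #|j |: zeros b|).
  apply/subset_leq_card/subsetP => i; rewrite !inE bE => /eqP f0.
  case: (eqVneq i j) => //= neij.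
  by rewrite !mxE f0 add0r eqxx (negbTE neij) mulr0.
by rewrite cardsU1 -add1n leq_add // leq_b1.
Qed.

Lemma card_vspace_ge n (F : {vspace 'rV['F_2]_n}) :
  (2 ^ \dim F <= #|[set x | x \in F]|)%N.
Proof.
pose f (c : {ffun 'I_(\dim F) -> 'F_2}) := \sum_i c i *: (vbasis F)`_i.
have f_inj : injective f.
  move=> c d /eqP; rewrite -subr_eq0 -sumrB => /eqP cd; apply/ffunP => i.
  apply/eqP; rewrite -subr_eq0; apply/eqP.
  have /freeP/(_ (fun i => c i - d i)) := basis_free (vbasisP F); apply.
  by rewrite -[RHS]cd; apply: eq_bigr => l _; rewrite scalerBl.
have := card_imset setT f_inj; rewrite cardsT card_ffun card_Fp // card_ord => <-.
apply/subset_leq_card/subsetP => _ /imsetP[c _ ->]; rewrite inE.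
by apply: memv_suml => i _; rewrite memvZ // vbasis_mem // mem_nth // size_tuple.
Qed.

(** Repetitions are allowed and zeros pad shorter sums: a superset of the subset sums that is easy
    to count. *)
Definition short_sums q n (Y : {set 'rV['F_2]_n}) : {set 'rV['F_2]_n} :=
  [set \sum_i f i | f : {ffun 'I_q -> 'rV['F_2]_n} in ffun_on [in 0 |: Y]].

Lemma card_short_sums q n (Y : {set 'rV['F_2]_n}) :
  (#|short_sums q Y| <= #|Y|.+1 ^ q)%N.
Proof.
apply: leq_trans (leq_imset_card _ _) _; rewrite card_ffun_on card_ord.
by case: q => // q; rewrite leq_exp2r // cardsU1 -[leqRHS]add1n leq_add2r leq_b1.
Qed.

Lemma mem_short_sums q n (Y T : {set 'rV['F_2]_n}) :
  T \subset Y -> (#|T| <= q)%N -> \sum_(x in T) x \in short_sums q Y.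
Proof.
move=> sTY leT; apply/imsetP; exists [ffun i : 'I_q => (enum T)`_i].
  apply/ffun_onP => i; rewrite ffunE !inE.
  have [lti|gei] := ltnP i (size (enum T)); last by rewrite nth_default ?eqxx.
  by rewrite (subsetP sTY) ?orbT // -mem_enum mem_nth.
rewrite -big_enum /= (big_nth 0) big_mkord.
under [RHS]eq_bigr do rewrite ffunE.
rewrite (big_ord_widen q (fun i => (enum T)`_i)) -?cardE // big_mkcond /=.
by apply: eq_bigr => i _; case: ltnP => // gei; rewrite nth_default // -cardE.
Qed.

Lemma sum_free_setU1 q n (Y : {set 'rV['F_2]_n}) v :
  sum_free q Y -> v \notin short_sums q Y -> sum_free q (v |: Y).
Proof.
move=> sfY vY T sT leT T0; have [vT|vT] := boolP (v \in T); last first.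
  apply: sfY => //; apply/subsetP => x xT; have := subsetP sT x xT.
  by case/setU1P => // xv; rewrite xv (negbTE vT) in xT.
case/negP: vY; have -> : v = \sum_(x in T :\ v) x.
  by apply/eqP; rewrite -[X in _ == X]F2_oppr -addr_eq0 -(big_setD1 v) //= T0.
apply: mem_short_sums; first by rewrite subDset.
by apply: leq_trans leT; rewrite subset_leq_card // subD1set.
Qed.

(** Bernoulli's inequality [(1 + 1/l)^l >= 2] for [L = l + 1]: every [L] greedy rounds at least
    halve the unmet indices. *)
Lemma double_expn_pred_le L : (0 < L)%N -> (2 * (L - 1) ^ L <= L ^ L)%N.
Proof.
case: L => // l _; rewrite subSS subn0.
have bern k : (l ^ k * (l + k) <= l.+1 ^ k * l)%N.
  elim: k => [|k IHk]; first by rewrite !mul1n addn0.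
  rewrite [(l.+1 ^ _)%N]expnS -mulnA; apply: leq_trans (leq_mul (leqnn l.+1) IHk).
  by rewrite expnS; set z := (l ^ k)%N; nia.
have := bern l; rewrite !expnS; case: l {bern} => // l; rewrite addnn -mul2n.
set a := (_ ^ _)%N; set b := (_ ^ _)%N => ab.
have : (2 * a <= b)%N by rewrite -(@leq_pmul2r l.+1) // mulnAC; lia.
nia.
Qed.

Lemma linear_lt_exp a b : exists j, (a * j + b <= 2 ^ j)%N.
Proof.
have sq j : (4 <= j -> j * j <= 2 ^ j)%N.
  elim: j => // j IHj; rewrite leq_eqVlt => /orP[/eqP<- //|lej].
  by have := IHj lej; rewrite expnS; nia.
exists (a + b + 4)%N; apply: leq_trans (sq _ (leq_addl _ _)); nia.
Qed.

(** The base on the left is the number of greedy rounds, so its power bounds the number of short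
    sums; it is polynomial in [n], while the right side is exponential. *)
Lemma exists_dim_bound q t k : exists2 n, (t < n)%N &
  ((2 ^ (k + t).+1 * ((n + k) * (n + k)).+1) ^ q <= 2 ^ (n - t.+1))%N.
Proof.
have [j hj] := linear_lt_exp (2 * q) ((3 * k + t + 3) * q + t.+1).
(* For [n] a power of 2 both sides compare through their exponents, linear in [j] against
   [2 ^ j]. *)
exists (2 ^ j)%N; first by lia.
apply: (@leq_trans ((2 ^ (3 * k + t + 3 + 2 * j)) ^ q)).
  case: q {hj} => // q; rewrite leq_exp2r //.
  have le1 : (2 ^ j + k <= 2 ^ j * 2 ^ k)%N.
    have := ltn_expl k (isT : 1 < 2)%N; have : (0 < 2 ^ j)%N by rewrite expn_gt0.
    by nia.
  have le2 : (((2 ^ j + k) * (2 ^ j + k)).+1 <= 2 * ((2 ^ j * 2 ^ k) * (2 ^ j * 2 ^ k)))%N.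
    have := leq_mul le1 le1; have : (0 < 2 ^ j * 2 ^ k)%N by rewrite muln_gt0 !expn_gt0.
    by move=> *; nia.
  apply: leq_trans (leq_mul (leqnn _) le2) _.
  by rewrite -!expnD -expnS -expnD leq_exp2l //; lia.
by rewrite -expnM leq_exp2l //; move: hj; lia.
Qed.

Lemma exists_sum_free_hits q t k : exists n (X : {set 'rV['F_2]_(n + k)}),
  [/\ hits t X, sum_free q X &
      forall x, x \in X -> (#|zeros (rsubmx x)| <= t)%N].
Proof.
(* [L] is the ratio of all [2 ^ (n + k)] vectors to the [2 ^ (n - t - 1)] that will be shown usable
   for each subspace. *)
have [n lt_tn] := exists_dim_bound q t k; set L := (2 ^ (k + t).+1)%N.
set m := (L * _)%N => lem; exists n.
have L0 : (0 < L)%N by rewrite expn_gt0.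
pose V := 'rV['F_2]_(n + k).
(* Subspaces are indexed by spanning tuples, a finite type with at most [2 ^ ((n + k) * (n + k))]
   members. *)
pose D := [set B : (n + k).-tuple V | (n + k <= \dim <<B>> + t)%N].
pose P (Y : {set V}) := sum_free q Y /\
  forall x, x \in Y -> (#|zeros (rsubmx x)| <= t)%N.
pose allowed (Y : {set V}) :=
  [set v : V | (#|zeros (rsubmx v)| <= t)%N && (v \notin short_sums q Y)].
have [| | | | |X [sfX wX] hX] :=
  @greedy_transversal V _ D (fun B v => v \in <<B>>%VS) P allowed L m L0.
- by rewrite card_rV expn_gt0.
- split=> [T|x]; last by rewrite inE.
  by rewrite subset0 => /eqP.
- move=> Y v [sfY wY]; rewrite inE => /andP[wv sv]; split.
    exact: sum_free_setU1.
  by move=> x /setU1P[->|/wY].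
- move=> Y B [_ _] ltY; rewrite inE => dimB; set F := <<B>>%VS in dimB *.
  have [b bF bz] := few_zeros dimB.
  have wb : (#|zeros (rsubmx b)| <= t)%N.
    rewrite -(card_imset _ (@rshift_inj n k)); apply: leq_trans bz.
    apply/subset_leq_card/subsetP => _ /imsetP[i + ->].
    by rewrite !in_set mxE.
  (* Translating [b] by [F :&: K] stays in [F] and keeps the last [k] coordinates. This gives
     [2 ^ (n - t)] candidates, of which short sums exclude at most half. *)
  pose K := lker (linfun (@rsubmx 'F_2 1 n k)).
  have dimK : (n <= \dim (F :&: K) + t)%N.
    have := limg_ker_dim (linfun (@rsubmx 'F_2 1 n k)) F; rewrite -/K.
    have := dim_rV_le (linfun (@rsubmx 'F_2 1 n k) @: F); move: dimB.
    set x := \dim F; set y := \dim (F :&: K); set z := \dim (_ @: F)%VS; lia.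
  have le1 : (2 ^ (n - t) <= #|[set v : V | (v \in F) && (#|zeros (rsubmx v)| <= t)%N]|)%N.
    apply: leq_trans (leq_trans _ (card_vspace_ge (F :&: K))) _.
      by rewrite leq_exp2l // leq_subLR addnC.
    rewrite -[X in (X <= _)%N](@card_imset _ _
      (fun v : 'rV['F_2]_(n + k) => b + v) _ (addrI b)).
     apply/subset_leq_card/subsetP => _ /imsetP[v + ->].
    rewrite !in_set memv_cap memv_ker lfunE /= linearD /= => /andP[vF /eqP->].
    by rewrite memvD // addr0.
  have le2 : (#|short_sums q Y| <= 2 ^ (n - t.+1))%N.
    apply: leq_trans (card_short_sums _ _) (leq_trans _ lem).
    by case: (q) => // q'; rewrite leq_exp2r.
  have nE : (2 ^ (n - t) = 2 ^ (n - t.+1) + 2 ^ (n - t.+1))%N.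
    by rewrite addnn -mul2n -expnS subnSK.
  have : (2 ^ (n - t.+1) <= #|[set v in allowed Y | v \in F]|)%N.
    have -> : [set v in allowed Y | v \in F] =
        [set v : V | (v \in F) && (#|zeros (rsubmx v)| <= t)%N] :\: short_sums q Y.
      by apply/setP => v; rewrite !in_set; case: (v \in F); rewrite ?andbT ?andbF // andbC.
    rewrite cardsD leq_subRL; last by apply: subset_leq_card; apply: subsetIl.
    apply: leq_trans le1; rewrite nE leq_add2r.
    by apply: leq_trans le2; apply: subset_leq_card; apply: subsetIr.
  rewrite -(leq_pmul2l L0); apply: leq_trans.
  by rewrite card_rV -expnD leq_exp2l //; lia.
- have cardD : (#|D| <= 2 ^ ((n + k) * (n + k)))%N.
    by rewrite expnM -[X in (X ^ _)%N]card_rV -card_tuple max_card.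
  rewrite /m !expnM; set s := ((n + k) * (n + k))%N in cardD *.
  (* The [L * s.+1] rounds halve at most [2 ^ s] indices [s.+1] times. *)
  have bL : (2 ^ s.+1 * ((L - 1) ^ L) ^ s.+1 <= (L ^ L) ^ s.+1)%N.
    by rewrite -expnMn leq_exp2r // double_expn_pred_le.
  have : (0 < (L ^ L) ^ s.+1)%N by rewrite !expn_gt0.
  have := leq_mul cardD (leqnn (((L - 1) ^ L) ^ s.+1)).
  move: bL; rewrite [(2 ^ s.+1)%N]expnS -mulnA.
  set x := (_ * _ ^ _)%N; set y := (_ ^ s.+1)%N; set z := (_ * _)%N; lia.
exists X; split => // F dimF.
(* Past the end of the basis the default entry 0 pads the tuple without changing the span. *)
pose B := [tuple (vbasis F)`_i | i < n + k].
have BF : <<B>>%VS = F.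
  apply/eqP; rewrite eqEsubv; apply/andP; split.
    apply/span_subvP => _ /mapP[i _ ->].
    have [lti|gei] := ltnP i (size (vbasis F)); first exact/vbasis_mem/mem_nth.
    by rewrite nth_default ?mem0v.
  rewrite -{1}(span_basis (vbasisP F)); apply/span_subvP => x xF.
  apply: memv_span; apply/mapP.
  have lti : (index x (vbasis F) < n + k)%N.
    rewrite (leq_trans _ (dim_rV_le F)) //.
    by rewrite -[X in (_ < X)%N](size_tuple (vbasis F)) index_mem.
  by exists (Ordinal lti); rewrite ?mem_enum //= nth_index.
by have [|v vX] := hX B; [rewrite inE BF | rewrite BF => vF; exists v].
Qed.

(** * Binomial estimates and vectors with many zeros *)

Lemma bin_le_central m j : ('C(2 * m, j) <= 'C(2 * m, m))%N.
Proof.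
have lower i : (i <= m -> 'C(2 * m, m - i) <= 'C(2 * m, m))%N.
  elim: i => [|i IHi] lei; first by rewrite subn0.
  apply: leq_trans (IHi (ltnW lei)).
  have jE : (m - i = (m - i.+1).+1)%N by lia.
  rewrite jE; set l := (m - i.+1)%N; have lE : (l + i.+1 = m)%N by rewrite /l; lia.
  have := mul_bin_left (2 * m) l.
  rewrite -(@leq_pmul2l l.+1) // => ->; rewrite leq_mul2r; apply/orP; right.
  by lia.
have [lej|ltj] := leqP j m; first by rewrite -(subKn lej) lower ?leq_subr.
have [lej|ltj2] := leqP j (2 * m); last by rewrite bin_small.
rewrite -bin_sub // (_ : 2 * m - j = m - (j - m))%N; last by lia.
by apply: lower; lia.
Qed.

(** The central layer has share at most [1/sqrt(2m + 1)], squared to stay in integers. The induction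
    step rests on [(2m + 1)(2m + 3) <= (2m + 2)^2]. *)
Lemma central_bin_bound m : ('C(2 * m, m) ^ 2 * (2 * m).+1 <= 16 ^ m)%N.
Proof.
elim: m => // m IHm.
have binE : (m.+1 * 'C(2 * m.+1, m.+1) = 2 * (2 * m).+1 * 'C(2 * m, m))%N.
  rewrite (_ : 2 * m.+1 = (2 * m).+2)%N; last by lia.
  have h1 := mul_bin_diag (2 * m).+2 m.
  have h2 := mul_bin_down (2 * m).+1 m.
  rewrite (_ : (2 * m).+1 - m = m.+1)%N in h2; last by lia.
  rewrite /= in h1 h2; nia.
rewrite -(@leq_pmul2l (m.+1 ^ 2)) // mulnA -expnMn binE [(16 ^ _)%N]expnS.
move: IHm; set a := 'C(_, _); set b := (16 ^ m)%N => IHm.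
apply: (@leq_trans (4 * (2 * m).+1 * (2 * m).+3 * (a ^ 2 * (2 * m).+1))); first by nia.
apply: (@leq_trans (4 * (2 * m).+1 * (2 * m).+3 * b)); first by rewrite leq_mul2l IHm orbT.
by rewrite mulnA leq_mul2r; apply/orP; right; nia.
Qed.

Lemma card_zeros_eq k j : (#|[set x : 'rV['F_2]_k | #|zeros x| == j]| <= 'C(k, j))%N.
Proof.
have zeros_inj : injective (@zeros k).
  move=> x y /setP xy; apply/rowP => i; have := xy i; rewrite !inE.
  by case: (x 0 i) => [[|[|[]]]] // ?; case: (y 0 i) => [[|[|[]]]] // ? _; apply/val_inj.
rewrite -(card_imset _ zeros_inj) -[k in 'C(k, _)]card_ord -card_draws.
by apply/subset_leq_card/subsetP => _ /imsetP[x + ->]; rewrite !inE.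
Qed.

(* Flipping all coordinates exchanges the two tails, and the middle layers are
   negligible. *)
Lemma many_zeros_half s u : exists k,
  (2 ^ k * u <= 2 * #|[set x : 'rV['F_2]_k | k + s < 2 * #|zeros x|]| * u + 2 ^ k)%N.
Proof.
(* The square makes [2m + 1] at least [((2s + 1) u)^2], so that [2s + 1] layers of central size hold
   at most [2^k / u] vectors. *)
pose m := (s + ((2 * s).+1 * u) ^ 2)%N; exists (2 * m)%N; set k := (2 * m)%N.
pose A := [set x : 'rV['F_2]_k | k + s < 2 * #|zeros x|]%N; rewrite -/A.
pose B := [set x : 'rV['F_2]_k | 2 * #|zeros x| + s < k]%N.
pose C := [set x : 'rV['F_2]_k | k <= 2 * #|zeros x| + s <= k + 2 * s]%N.
have AB : #|A| = #|B|.
  have inj : injective (fun x : 'rV['F_2]_k => const_mx 1 + x) by apply: addrI.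
  have flip x : #|zeros (const_mx 1 + x : 'rV['F_2]_k)| = (k - #|zeros x|)%N.
    have -> : zeros (const_mx 1 + x) = ~: zeros x.
      by apply/setP => i; rewrite !inE !mxE; case: (x 0 i) => [[|[|[]]]].
    by have := cardsC (zeros x); rewrite card_ord; lia.
  have zk (x : 'rV['F_2]_k) : (#|zeros x| <= k)%N.
    by rewrite -[leqRHS]card_ord max_card.
  apply/eqP; rewrite eqn_leq; apply/andP; split.
    rewrite -(card_imset _ inj); apply/subset_leq_card/subsetP => _ /imsetP[x + ->].
    by rewrite !inE flip; have := zk x; lia.
  rewrite -(card_imset _ inj); apply/subset_leq_card/subsetP => _ /imsetP[x + ->].
  by rewrite !inE flip; have := zk x; lia.
have total : (2 ^ k <= #|A| + #|B| + #|C|)%N.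
  have E : [set: 'rV['F_2]_k] = A :|: B :|: C.
    by apply/setP => x; rewrite !inE; lia.
  rewrite -card_rV -cardsT E; apply: leq_trans (leq_card_setU _ _) _.
  by rewrite leq_add2r leq_card_setU.
have Cle : (#|C| <= (2 * s).+1 * 'C(k, m))%N.
  have sub : C \subset \bigcup_(i < (2 * s).+1)
      [set x : 'rV['F_2]_k | #|zeros x| == m - s + i]%N.
    apply/subsetP => x; rewrite inE => xC.
    have lti : (#|zeros x| - (m - s) < (2 * s).+1)%N by move: xC; rewrite /k; lia.
    apply/bigcupP; exists (Ordinal lti) => //; rewrite inE /=.
    have /andP[lo _] := xC; rewrite subnKC // leq_subLR -(leq_pmul2l (isT : 0 < 2)%N).
    by apply: leq_trans lo _; rewrite mulnDr addnC leq_add2r leq_pmull.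
  apply: leq_trans (subset_leq_card sub) _.
  apply: leq_trans (_ : _ <= \sum_(i < (2 * s).+1) 'C(k, m))%N _; last first.
    by rewrite sum_nat_const card_ord.
  elim/big_ind2: _ => [|a b c d ab cd|i _]; first by rewrite cards0.
    exact: leq_trans (leq_card_setU _ _) (leq_add ab cd).
  exact: leq_trans (card_zeros_eq _ _) (bin_le_central _ _).
have Cu : (#|C| * u <= 2 ^ k)%N.
  rewrite -leq_sqr; apply: (@leq_trans ('C(k, m) ^ 2 * (2 * m).+1)).
    apply: (@leq_trans (((2 * s).+1 * 'C(k, m) * u) ^ 2)).
      by rewrite leq_sqr leq_mul2r Cle orbT.
    rewrite mulnAC expnMn mulnC leq_mul2l; apply/orP; right.
    by rewrite /m; set v := (_ ^ 2)%N; lia.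
  apply: leq_trans (central_bin_bound m) _.
  by rewrite -expnM /k mulnAC expnM.
have := leq_mul total (leqnn u); rewrite AB; lia.
Qed.

(** * Odd circuits and the exclusion of [N] *)

Lemma card_rsub_preim n k (A : {set 'rV['F_2]_k}) :
  #|[set x : 'rV['F_2]_(n + k) | rsubmx x \in A]| = (2 ^ n * #|A|)%N.
Proof.
rewrite -card_rV -cardsT -cardsX.
rewrite -(@card_imset _ _ (fun p : 'rV['F_2]_n * 'rV['F_2]_k => row_mx p.1 p.2)).
  congr #|pred_of_set _|; apply/setP => x; rewrite inE; apply/idP/imsetP => [xA|].
    by exists (lsubmx x, rsubmx x); rewrite ?hsubmxK // !inE.
  by case=> -[u v]; rewrite !inE /= => vA ->; rewrite row_mxKr.
by move=> [a b] [a' b'] /= /eq_row_mx[-> ->].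
Qed.

(** In a coordinate where no term vanishes the sum is an odd number of ones, hence 1; so each zero
    of the sum is a zero of some term. *)
Lemma zeros_odd_sum (I : finType) (C : {set I}) k t (w : I -> 'rV['F_2]_k) :
  (forall i, i \in C -> (#|zeros (w i)| <= t)%N) -> odd #|C| ->
  (#|zeros (\sum_(i in C) w i)| <= #|C| * t)%N.
Proof.
move=> wt oddC; apply: (@leq_trans #|\bigcup_(i in C) zeros (w i)|).
  apply/subset_leq_card/subsetP => l; rewrite inE summxE; apply: contraTT => nz.
  have w1 i : i \in C -> w i 0 l = 1.
    move=> iC; apply/eqP; rewrite -F2_eq1; apply: contra nz => wl.
    by apply/bigcupP; exists i; rewrite // inE.
  by rewrite (eq_bigr _ w1) sumr_const F2_natr_odd oddC.
rewrite -sum_nat_const; elim/big_ind2: _ => [|a b c d ab cd|i /wt //].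
  by rewrite cards0.
exact: leq_trans (leq_card_setU _ _) (leq_add ab cd).
Qed.

Lemma zeros_add k (a b : 'rV['F_2]_k) :
  (#|zeros a| + #|zeros b| <= #|zeros (a + b)| + k)%N.
Proof.
rewrite -cardsUI addnC; apply: leq_add; last by rewrite -[leqRHS]card_ord max_card.
apply/subset_leq_card/subsetP => i; rewrite !inE mxE => /andP[/eqP-> /eqP->].
by rewrite addr0.
Qed.

(** The first coordinate of [g] is 1 exactly off [H], so a circuit has an even number of elements
    there. None is impossible since [H] cuts out an independent set; two are excluded by counting
    zeros. *)
Lemma embedded_class_0 N c n k t (X A : {set 'rV['F_2]_(n + k)}) S
    (g : 'Hom('rV['F_2]_(ambient N), 'rV['F_2]_(1 + (n + k)))) :
  (forall x, x \in X -> (#|zeros (rsubmx x)| <= t)%N) ->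
  (forall x, x \in A -> (k + #|ground N| * t < 2 * #|zeros (rsubmx x)|)%N) ->
  @embedded N c _ X A S g -> class_0 (restriction N S).
Proof.
move=> Xz Az [codS crit2 codH indH [g_inj gim]]; split=> //.
exists [set x in S | lsubmx (g x) == 0]; split=> // C circC oddC.
have sSN : S \subset ground N.
  by case: codS => F _ ->; apply/subsetP => x; rewrite inE => /andP[].
have gS : ground (restriction N S) = S by apply/setIidPr.
have sCS : C \subset S by have := circuit_sub circC; rewrite gS.
have C0 : \sum_(x in C) x = 0 := circuit_sum circC.
rewrite gS; pose C1 := [set x in C | lsubmx (g x) != 0].
pose C2 := [set x in C | lsubmx (g x) == 0].
have -> : C :&: (S :\: [set x in S | lsubmx (g x) == 0]) = C1.
  apply/setP => x; rewrite !in_setI !in_setD !in_set.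
  by case xC: (x \in C) => //=; rewrite (subsetP sCS) //= andbT.
have lE x : x \in C1 -> lsubmx (g x) 0 0 = 1.
  rewrite in_set => /andP[_ lx]; apply/eqP; rewrite -F2_eq1.
  by apply: contra lx => /eqP lx; apply/eqP/rowP => i; rewrite (ord1 i) lx mxE.
have split_sum p (F : _ -> 'rV['F_2]_p) :
    \sum_(x in C) F x = \sum_(x in C1) F x + \sum_(x in C2) F x.
  rewrite (bigID (fun x => lsubmx (g x) != 0)) /=; congr (_ + _); apply: eq_bigl => x.
    by rewrite in_set.
  by rewrite in_set negbK.
have gsum0 : \sum_(x in C) g x = 0 by rewrite -linear_sum C0 linear0.
have even1 : ~~ odd #|C1|.
  have : (\sum_(x in C) lsubmx (g x)) 0 0 = 0 by rewrite -linear_sum gsum0 !mxE.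
  rewrite split_sum [X in _ + X]big1 ?addr0; last by move=> x; rewrite in_set => /andP[_ /eqP].
  rewrite summxE (eq_bigr (fun _ => 1)) // sumr_const F2_natr_odd.
  by case: (odd _).
rewrite leqNgt; apply/negP => lt4.
have CE : (#|C| = #|C1| + #|C2|)%N.
  rewrite -(cardsID [set x | lsubmx (g x) != 0] C); congr (_ + _)%N; apply: eq_card => x.
    by rewrite in_setI !in_set.
  by rewrite in_setD !in_set negbK andbC.
have odd2 : odd #|C2| by move: oddC; rewrite CE oddD (negbTE even1).
have [C1_0|C1_2] : #|C1| = 0%N \/ #|C1| = 2%N.
  by move: even1 lt4; case: #|C1| => [|[|[|[|]]]] //; [left | right].
  have : C = set0.
    move/indepP: indH; apply => //; apply/subsetP => x xC.
    rewrite in_set (subsetP sCS) //=; apply: contraT => lx.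
    by move/eqP: C1_0; rewrite cards_eq0 => /eqP/setP/(_ x); rewrite !in_set xC lx.
  by move=> C_0; rewrite C_0 cards0 in oddC.
pose w x := rsubmx (rsubmx (g x)).
have C2X x : x \in C2 -> rsubmx (g x) \in X.
  rewrite in_set => /andP[xC lx]; have := gim x (subsetP sCS x xC).
  by rewrite in_set lx.
have C1A x : x \in C1 -> rsubmx (g x) \in A.
  rewrite in_set => /andP[xC lx]; have := gim x (subsetP sCS x xC).
  by rewrite in_set (negbTE lx).
have z2 : (#|zeros (\sum_(x in C2) w x)| <= #|ground N| * t)%N.
  apply: leq_trans (@zeros_odd_sum _ C2 k t w _ odd2) _.
    by move=> x /C2X; apply: Xz.
  rewrite leq_mul2r subset_leq_card ?orbT //.
  by apply/subsetP => x; rewrite in_set => /andP[xC _]; rewrite (subsetP sSN) // (subsetP sCS).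
(* In characteristic 2 the parts of the circuit off [H] and in [H] have equal sums: the former has
   more than [#|ground N| * t] zeros, the latter at most that many. *)
have w0 : \sum_(x in C1) w x = \sum_(x in C2) w x.
  apply/eqP; rewrite -[X in _ == X]F2_oppr -addr_eq0 -split_sum.
  rewrite -(linear_sum (@rsubmx 'F_2 1 n k)) -(linear_sum (@rsubmx 'F_2 1 1 (n + k))).
  by rewrite gsum0 !linear0.
have /cards2P[a [b [neqab C1E]]] : #|C1| == 2%N by rewrite C1_2.
have aC : a \in C1 by rewrite C1E !inE eqxx.
have bC : b \in C1 by rewrite C1E !inE eqxx orbT.
move: w0; rewrite C1E big_setU1 ?in_set1 // big_set1 => w0.
have := zeros_add (w a) (w b); rewrite w0.
have := Az _ (C1A a aC); have := Az _ (C1A b bC); rewrite -/(w a) -/(w b).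
by move: z2; lia.
Qed.

(** All of [S] would lie over [H] and be independent, giving critical number at most 1 instead of
    2. *)
Lemma not_embedded_set0 N c n (X : {set 'rV['F_2]_n}) S g :
  ~ @embedded N c n X set0 S g.
Proof.
case=> -[F _ SE] crit2 _ indH [_ gim].
have gS : ground (restriction N S) = S.
  by apply/setIidPr; rewrite SE; apply/subsetP => x; rewrite in_set => /andP[].
have indS : indep S.
  apply: indepS indH; apply/subsetP => x xS; rewrite in_set xS /=.
  by have := gim x xS; rewrite in_set in_set0; case: (lsubmx _ == 0).
have [G dimG disjG] := indep_avoid indS.
suff : (critical_number (restriction N S) <= 1)%N by rewrite crit2.
by apply/critical_number_leP; exists G => // x; rewrite gS => /disjG.
Qed.

(** * The three values of [delta] *)

Theorem theorem5p4 (R : realType) (N : sbmatroid) (r c : nat)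
  (hr : rank N = r)
  (hc : critical_number N = c) (c_ge2 : (2 <= c)%N)
  (delta : R)
  (hdelta : has_subspace_in_class N (c - 2) delta)
  (delta_min : forall delta' : R,
     has_subspace_in_class N (c - 2) delta' -> delta <= delta') :
  1 - (1 - delta) * 2 ^ (2%:Z - c%:Z) <= critical_threshold R N.
Proof.
have -> : (2%:Z - c%:Z = - (c - 2)%N%:Z)%R by rewrite -opprB subzn.
rewrite -exprnN; apply: critical_threshold_ge => // e t e0.
set q := #|ground N|.
case: hdelta => _ _ [[-> _]|[dE _]|[dE _]].
- have [n [X [hX sfX _]]] := exists_sum_free_hits q.+1 t 0.
  exists (n + 0)%N, X, set0; split=> //; last exact: not_embedded_set0.
  by rewrite cards0 mulr_le0_ge0 // ?sub0r ?oppr_le0 ?exprn_ge0 // ltW.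
(* With [u > 1/e], the set [B] has density at least [(1 - e) / 2] in its space; [A] has the same
   density in one of the two cosets, thus at least [(1 - e) / 4] in [W]. *)
- have [k hk] := many_zeros_half (q * t) (Num.bound e^-1).
  have [n [X [hX sfX Xz]]] := exists_sum_free_hits q.+1 t k.
  pose B := [set x : 'rV['F_2]_k | k + q * t < 2 * #|zeros x|]%N.
  exists (n + k)%N, X, [set x | rsubmx x \in B]; split=> // [|S g emb].
    rewrite card_rsub_preim dE !exprD natrM natrX expr1.
    have := archi_boundP (ltW (_ : 0 < e^-1)); rewrite invr_gt0 => /(_ e0).
    rewrite -(ltr_pM2r e0) mulVf ?gt_eqF //.
    move: hk; rewrite -/B -(ler_nat R) natrD !natrM natrX.
    have : 0 < 2 ^+ k :> R by rewrite exprn_gt0.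
    have : 0 < 2 ^+ n :> R by rewrite exprn_gt0.
    set u := (Num.bound _)%:R; set K := 2 ^+ k; set m := 2 ^+ n; set a := #|B|%:R.
    move=> m0 K0 hk ue.
    have u0 : 0 < u by rewrite -(pmulr_lgt0 _ e0); apply: lt_trans ue.
    suff aK : K / 2 - e * K / 2 <= a.
      have h1 : 0 <= m * (a - (K / 2 - e * K / 2)) by rewrite mulr_ge0 ?subr_ge0 // ltW.
      have h2 : 0 < m * K * e by rewrite !mulr_gt0.
      by lra.
    rewrite -(ler_pM2r u0); have : 0 < K * (u * e - 1) by rewrite mulr_gt0 ?subr_gt0.
    by lra.
  have : delta <= 0; last by rewrite dE; lra.
  apply: delta_min; exists S; first by case: emb.
  apply: Or31; split=> //; apply: (embedded_class_0 Xz _ emb) => x.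
  by rewrite !in_set.
(* Here [delta = 1/2]: the full coset is exactly half of [W]. *)
have [n [X [hX sfX _]]] := exists_sum_free_hits q.+1 t 0.
exists (n + 0)%N, X, setT; split=> // [|S g [codS crit2 codH indH _]].
  rewrite cardsT card_rV natrX exprS.
  by have : 0 < 2 ^+ (n + 0) :> R by [rewrite exprn_gt0]; rewrite dE; nra.
(* The independent 1-codimensional subspace puts the restriction in class 0 or 1/4, against the
   minimality of 1/2. *)
have [d' [d'lt cl]] : exists d' : R, d' < 1 / 2 /\ in_class d' (restriction N S).
  have [c0|nc0] := pselect (class_0 (restriction N S)).
    by exists 0; split; [lra | apply: Or31].
  exists (1 / 4); split; first by lra.
  by apply: Or32; split=> //; split=> //; exists [set x in S | lsubmx (g x) == 0].
have : delta <= d' by apply: delta_min; exists S.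
by rewrite dE leNgt d'lt.
Qed.
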